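(* Let $(\mathbf{x}_i,y_i)$, $i=1,\dots,n$, follow the regression model described in the context, and consider a linear procedure with hat matrix $\mathbf{H}$ and hat vector $\mathbf{h}_\ast$ at an independent test point $\mathbf{x}_\ast$, with fitted values $\hat\mu_1,\dots,\hat\mu_n$ and prediction $\hat\mu_\ast$ at $\mathbf{x}_\ast$. Then $$\mathrm{df}_{\rm R}-\mathrm{df}_{\rm F}=\frac{n}{2}\sum_{i=1}^n\left[\mathrm{E}\left(\frac{\mathrm{Cov}^2(y_i,\hat\mu_\ast\mid \mathbf{x}_\ast,\mathbf{X})}{(\sigma_\varepsilon^2)^2}\,\Bigg|\,\mathbf{X}\right)-\frac1n\sum_{j=1}^n\frac{\mathrm{Cov}^2(y_i,\hat\mu_j\mid\mathbf{X})}{(\sigma_\varepsilon^2)^2}\right].$$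
   Context: Model: $y_i=\mu_i+\varepsilon_i$ with $\mu_i=\mu(\mathbf{x}_i;\boldsymbol\beta)$, $i=1,\dots,n$, where $\mu(\cdot;\boldsymbol\beta):\mathbb{R}^d\to\mathbb{R}$ is the mean regression function; $\mathbf{x}_1,\dots,\mathbf{x}_n\in\mathbb{R}^d$ are i.i.d. with mean $\mathbf 0$ and covariance matrix $\boldsymbol\Sigma$; $\varepsilon_1,\dots,\varepsilon_n$ are i.i.d. with mean $0$ and variance $\sigma_\varepsilon^2>0$; the $\mathbf{x}_i$'s are independent of the $\varepsilon_i$'s. Write $\mathbf{y}=(y_1,\dots,y_n)^\top$ and let $\mathbf{X}$ be the $n\times d$ matrix with rows $\mathbf{x}_i^\top$. The test point $\mathbf{x}_\ast$ is an independent copy of $\mathbf{x}_i$, independent of the training data. Linear procedure: the fitted values are $\hat{\boldsymbol\mu}=(\hat\mu_1,\dots,\hat\mu_n)^\top=\mathbf{H}\mathbf{y}$ with hat matrix $\mathbf{H}=(h_{ij})\in\mathbb{R}^{n\times n}$ depending only on $\mathbf{X}$, and the prediction at $\mathbf{x}_\ast$ is $\hat\mu_\ast=\mathbf{h}_\ast^\top\mathbf{y}$ with hat vector $\mathbf{h}_\ast\in\mathbb{R}^n$ depending only on $\mathbf{X}$ and $\mathbf{x}_\ast$; expectations appearing below are assumed finite. Classical model degrees of freedom: $\mathrm{df}_{\rm F}=\sum_{i=1}^n \mathrm{Cov}(y_i,\hat\mu_i\mid\mathbf{X})/\sigma_\varepsilon^2$, which equals $\mathrm{tr}(\mathbf{H})$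 for a linear procedure. Predictive model degrees of freedom: $$\mathrm{df}_{\rm R}=\mathrm{tr}(\mathbf{H})+\frac n2\left(\mathrm{E}(\|\mathbf{h}_\ast\|^2\mid\mathbf{X})-\frac1n\mathrm{tr}(\mathbf{H}^\top\mathbf{H})\right).$$ $\mathrm{Cov}^2$ denotes the square of the covariance. *)

(* Defs.v *)
From HB Require Import structures.
From mathcomp Require Import all_boot all_order all_algebra.
From mathcomp Require Import all_classical all_reals all_analysis.

Set Implicit Arguments.
Unset Strict Implicit.
Unset Printing Implicit Defensive.

Import Order.TTheory GRing.Theory Num.Theory.
Import numFieldNormedType.Exports.

Local Open Scope classical_set_scope.
Local Open Scope ring_scope.

(* Matrices carry the product sigma-algebra, generated by the entries. For
   matrices over a realType this is the Borel sigma-algebra. *)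

Definition measure_mx_display : measure_display -> measure_display.
Proof. exact. Qed.

Section measurable_matrix.
Context {disp : measure_display} {T : measurableType disp} (m n : nat).

Definition mx_measurable : set (set 'M[T]_(m, n)) :=
  <<s \bigcup_(ij : 'I_m * 'I_n)
        preimage_set_system setT (fun A : 'M[T]_(m, n) => A ij.1 ij.2)
          measurable >>.

Let mx_measurable0 : mx_measurable set0.
Proof. exact: sigma_algebra0. Qed.

Let mx_measurableC A : mx_measurable A -> mx_measurable (~` A).
Proof. by move=> mA; rewrite -setTD; exact: sigma_algebraCD. Qed.

Let mx_measurable_bigcup (F : (set 'M[T]_(m, n))^nat) :
  (forall i, mx_measurable (F i)) -> mx_measurable (\bigcup_i F i).
Proof. exact: sigma_algebra_bigcup. Qed.

HB.instance Definition _ := @isMeasurable.Build (measure_mx_display disp)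
  'M[T]_(m, n) mx_measurable mx_measurable0 mx_measurableC mx_measurable_bigcup.

End measurable_matrix.

Section conditional_expectation.
Context {disp : measure_display} {T : measurableType disp} {R : realType}.
Variables (P : probability T R) (G : set (set T)).
Implicit Types (Z W : T -> R).

(* Conditional expectations given a sub-sigma-algebra G are taken in the
   generalized sense: Z need not be integrable, it suffices that E(|Z| | G) is
   finite almost surely, i.e. that Z is integrable on each member of a countable
   cover of the sample space by events of G. For integrable Z (take the cover
   to be the whole space) this is the usual notion. *)
Definition cond_integrable Z :=
  exists A : (set T)^nat,
    [/\ forall k, G (A k),
        \bigcup_k A k = setT &
        forall k, P.-integrable (A k) (EFin \o Z)].

Definition is_cond_exp Z W :=
  [/\ cond_integrable Z,
      forall B : set R, measurable B -> G (W @^-1` B) &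
      forall A, G A -> P.-integrable A (EFin \o Z) ->
        P.-integrable A (EFin \o W) /\
        (\int[P]_(t in A) (W t)%:E = \int[P]_(t in A) (Z t)%:E)%E].

(* E(Z | G): a version, unique up to a P-negligible set; 0 if Z is not
   conditionally integrable. *)
Definition cond_exp Z : T -> R := xget (cst 0) [set W | is_cond_exp Z W].

Definition cond_cov (U V : T -> R) : T -> R :=
  cond_exp (fun t => (U t - cond_exp U t) * (V t - cond_exp V t)).

End conditional_expectation.

Section independence.
Context {disp : measure_display} {T : measurableType disp} {R : realType}.
Variable P : probability T R.

Definition independent_RV {d1 d2 : measure_display} {T1 : measurableType d1}
    {T2 : measurableType d2} (U : T -> T1) (V : T -> T2) :=
  forall A B, measurable A -> measurable B ->
    (P (U @^-1` A `&` V @^-1` B) = P (U @^-1` A) * P (V @^-1` B))%E.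

Definition mutually_independent_RV {d1 : measure_display}
    {T1 : measurableType d1} {I : finType} (U : I -> T -> T1) :=
  forall (J : {set I}) (A : I -> set T1), (forall i, measurable (A i)) ->
    (P (\bigcap_(i in [set` J]) (U i @^-1` A i)) =
     \prod_(i in J) P (U i @^-1` A i))%E.

Definition identically_distributed {d1 : measure_display}
    {T1 : measurableType d1} (U V : T -> T1) :=
  forall A, measurable A -> P (U @^-1` A) = P (V @^-1` A).

End independence.

Section regression.
Context {disp : measure_display} {Omega : measurableType disp} {R : realType}.
Variables (P : probability Omega R) (n d : nat).
Variables (Theta : Type) (mu : 'cV[R]_d -> Theta -> R) (beta : Theta).
Variables (x : 'I_n -> {RV P >-> 'cV[R]_d}) (xstar : {RV P >-> 'cV[R]_d}).
Variable (eps : 'I_n -> {RV P >-> R}).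

Definition design_matrix (w : Omega) : 'M[R]_(n, d) :=
  \matrix_(i, k) x i w k 0.

Definition error_vector (w : Omega) : 'cV[R]_n := \col_i eps i w.

Definition response (w : Omega) : 'cV[R]_n :=
  \col_i (mu (x i w) beta + eps i w).

Record regression_model (Sigma : 'M[R]_d) (sigma2 : R) : Prop := {
  mu_measurable : measurable_fun setT (fun v => mu v beta);
  x_independent : mutually_independent_RV P (fun i => x i);
  x_identically_distributed :
    forall i j, identically_distributed P (x i) (x j);
  x_square_integrable :
    forall i k, (fun w => x i w k 0) \in Lfun P 2%:E;
  x_mean : forall i k, ('E_P[(fun w => x i w k 0)%R] = 0)%E;
  x_covariance : forall i k l,
    covariance P (fun w => x i w k 0) (fun w => x i w l 0) = (Sigma k l)%:E;
  eps_independent : mutually_independent_RV P (fun i => eps i);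
  eps_identically_distributed :
    forall i j, identically_distributed P (eps i) (eps j);
  eps_square_integrable : forall i, (eps i : Omega -> R) \in Lfun P 2%:E;
  eps_mean : forall i, ('E_P[eps i] = 0)%E;
  eps_variance : forall i, ('V_P[eps i] = sigma2%:E)%E;
  sigma2_gt0 : 0 < sigma2;
  x_eps_independent : independent_RV P design_matrix error_vector;
  xstar_identically_distributed :
    forall i, identically_distributed P xstar (x i);
  xstar_independent :
    independent_RV P xstar (fun w => (design_matrix w, response w)) }.

Definition sigma_X : set (set Omega) := g_sigma_algebra_preimage design_matrix.

Definition sigma_xstar_X : set (set Omega) :=
  g_sigma_algebra_preimage (fun w => (xstar w, design_matrix w)).

Variables (H : {mfun 'M[R]_(n, d) >-> 'M[R]_n})
  (h : {mfun ('M[R]_(n, d) * 'cV[R]_d)%type >-> 'cV[R]_n}).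

Definition hat_matrix (w : Omega) : 'M[R]_n := H (design_matrix w).

Definition hat_vector (w : Omega) : 'cV[R]_n := h (design_matrix w, xstar w).

Definition fitted (w : Omega) : 'cV[R]_n := hat_matrix w *m response w.

Definition prediction (w : Omega) : R := ((hat_vector w)^T *m response w) 0 0.

(* Squared Euclidean norm; the library's norm on matrices is the sup norm. *)
Definition sqnorm (m : nat) (v : 'cV[R]_m) : R := \sum_i v i 0 ^+ 2.

Definition df_F (sigma2 : R) (w : Omega) : R :=
  \sum_i cond_cov P sigma_X (fun w' => response w' i 0)
                            (fun w' => fitted w' i 0) w / sigma2.

Definition df_R (w : Omega) : R :=
  \tr (hat_matrix w) +
  n%:R / 2 *
  (cond_exp P sigma_X (fun w' => sqnorm (hat_vector w')) w
   - n%:R^-1 * \tr ((hat_matrix w)^T *m hat_matrix w)).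

End regression.

(* Main.v *)
Require Import Defs.
From HB Require Import structures.
From mathcomp Require Import all_boot all_order all_algebra.
From mathcomp Require Import all_classical all_reals all_analysis.
From mathcomp Require Import measurable_realfun.

(* Conditionally on a sigma-algebra G that is independent of the errors and
   makes the means m_i measurable, a combination sum_k a_k y_k with G-measurable
   coefficients has conditional mean sum_k a_k m_k, and
   Cov(y_i, sum_k a_k y_k | G) = sigma^2 a_i. With G = sigma(X) this gives
   Cov(y_i, muhat_j | X) = sigma^2 h_ji, and with G = sigma(xstar, X) it gives
   Cov(y_i, muhat_star | xstar, X) = sigma^2 (hstar)_i. Both sides then equal
   n/2 (sum_i E((hstar)_i^2 | X) - tr(H^T H) / n). Since xstar is independent of
   X, E((hstar)_i^2 | X) is obtained by integrating xstar out, so that no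
   Radon-Nikodym argument is needed. *)

Set Implicit Arguments.
Unset Strict Implicit.
Unset Printing Implicit Defensive.

Import Order.TTheory GRing.Theory Num.Theory.
Import numFieldNormedType.Exports.

Local Open Scope classical_set_scope.
Local Open Scope ring_scope.

(** * Conditional expectation *)

Section preimage_algebra.
Context {d d1 d2 : measure_display} {T : measurableType d}.
Context {T1 : measurableType d1} {T2 : measurableType d2}.
Variable f : T -> T1.
Hypothesis mf : measurable_fun setT f.

Lemma preimage_algebra_measurable (A : set T) :
  g_sigma_algebra_preimage f A -> measurable A.
Proof. by move=> [B mB <-]; exact: mf. Qed.

Lemma preimage_algebra_measurable_fun (W : T -> T2) :
  measurable_fun [set: g_sigma_algebra_preimageType f] W ->
  measurable_fun [set: T] W.
Proof.
by move=> mW _ B mB; apply: preimage_algebra_measurable; exact: mW.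
Qed.

Lemma preimage_algebra_measurable_funP (W : T -> T2) :
  measurable_fun [set: g_sigma_algebra_preimageType f] W <->
  forall B, measurable B -> g_sigma_algebra_preimage f (W @^-1` B).
Proof.
split=> [mW B mB|mW _ B mB]; last by rewrite setTI; exact: mW.
by have := mW measurableT B mB; rewrite setTI.
Qed.

Lemma preimage_algebra_comp (phi : T1 -> T2) : measurable_fun setT phi ->
  measurable_fun [set: g_sigma_algebra_preimageType f] (phi \o f).
Proof.
move=> mphi _ B mB; exists (phi @^-1` B) => //.
by rewrite -[X in measurable X]setTI; exact: mphi.
Qed.

End preimage_algebra.

(** * Versions of a conditional expectation given the sigma-algebra of [f] *)

Section cond_exp_theory.
Context {d d1 : measure_display} {T : measurableType d} {R : realType}.
Context {T1 : measurableType d1}.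
Variables (P : probability T R) (f : T -> T1).
Hypothesis mf : measurable_fun setT f.
Let G := g_sigma_algebra_preimage f.
Let TG := g_sigma_algebra_preimageType f.
Let GT (A : set T) : G A -> measurable A.
Proof. exact: preimage_algebra_measurable. Qed.

Lemma is_cond_exp_measurable (Z W : T -> R) : is_cond_exp P G Z W ->
  measurable_fun [set: TG] W.
Proof. by move=> [_ mW _]; apply/preimage_algebra_measurable_funP. Qed.

(** The one-sided form suffices: uniqueness follows by exchanging the two versions. The set where
    the inequality fails belongs to [G], and cutting it by the cover makes [Z] integrable there, so
    that both versions have the same integral on each piece. *)
Lemma is_cond_exp_le (Z W W' : T -> R) :
  is_cond_exp P G Z W -> is_cond_exp P G Z W' ->
  {ae P, forall w, W w <= W' w}.
Proof.
move=> ceW ceW'.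
have mW := is_cond_exp_measurable ceW.
have mW' := is_cond_exp_measurable ceW'.
have [[A [GA UA iA]] _ eqW] := ceW; have [_ _ eqW'] := ceW'.
pose E k := A k `&` [set w | W' w < W w].
have GE k : G (E k).
  apply: (@measurableI _ TG); first exact: GA.
  have := measurable_fun_ltr mW' mW measurableT (Y := [set true]).
  by rewrite setTI; exact.
have mE k : measurable (E k) by exact: GT.
have PE k : P (E k) = 0%E.
  have iE : P.-integrable (E k) (EFin \o Z).
    by apply: integrableS (iA k) => //; [exact/GT/GA|move=> w []].
  have [iW intW] := eqW _ (GE k) iE.
  have [iW' intW'] := eqW' _ (GE k) iE.
  (* On [E k] the difference [W - W'] is positive, so the integral of its absolute value is a
     difference of two equal finite integrals. *)
  have : (\int[P]_(w in E k) `|(W w)%:E - (W' w)%:E| = 0)%E.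
    transitivity (\int[P]_(w in E k) ((W w)%:E - (W' w)%:E))%E.
      apply: eq_integral => w /set_mem [_ /= /ltW h].
      by rewrite ger0_norm// subr_ge0.
    rewrite integralB//= intW intW' subee//.
    exact: integrable_fin_num.
  move/(ae_eq_integral_abs _ (mE k)) => /(_ _)[].
    by apply: emeasurable_funB; [exact: measurable_int iW|exact: measurable_int iW'].
  move=> N [mN N0 sub]; apply: subset_measure0 N0 => //.
  apply: subset_trans sub => w Ew /= /(_ Ew)/eqP.
  by case: Ew => _ /= h; rewrite -EFinB eqe subr_eq0 gt_eqF.
apply: negligibleS (negligible_bigcup (F := E) _).
  move=> w /= /negP; rewrite -ltNge => h.
  have : (\bigcup_k A k) w by rewrite UA.
  by move=> [k _ Ak]; exists k.
by move=> k; exists (E k); split; [exact: mE|exact: PE|].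
Qed.

Lemma is_cond_exp_unique (Z W W' : T -> R) :
  is_cond_exp P G Z W -> is_cond_exp P G Z W' ->
  {ae P, forall w, W w = W' w}.
Proof.
move=> ceW ceW'; have := is_cond_exp_le ceW ceW'.
by apply: filterS2 (is_cond_exp_le ceW' ceW) => w h h'; apply/le_anti/andP.
Qed.

Lemma cond_expP (Z W : T -> R) : is_cond_exp P G Z W ->
  is_cond_exp P G Z (cond_exp P G Z).
Proof. by move=> ceW; exact: (xgetI (cst 0) ceW). Qed.

(** This is how the chosen version is computed below: exhibit an explicit version, then transfer it
    almost surely. *)
Lemma cond_exp_ae (Z W : T -> R) : is_cond_exp P G Z W ->
  {ae P, forall w, cond_exp P G Z w = W w}.
Proof. by move=> ceW; exact: is_cond_exp_unique (cond_expP ceW) ceW. Qed.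

Lemma ae_eq_integrable (Z Z' : T -> R) (A : set T) : measurable A ->
  measurable_fun setT Z' -> {ae P, forall w, Z w = Z' w} ->
  P.-integrable A (EFin \o Z) -> P.-integrable A (EFin \o Z').
Proof.
move=> mA mZ' ZZ' /integrableP[mZ iZ].
have mZ'A : measurable_fun A (EFin \o Z').
  by apply/measurable_EFinP; exact: measurable_funS mZ'.
apply/integrableP; split => //.
rewrite (@ae_eq_integral _ _ _ P A (abse \o (EFin \o Z)))//.
- exact: measurableT_comp.
- exact: measurableT_comp.
- by apply: filterS ZZ' => w /= ->.
Qed.

(** Conditional covariances contain chosen versions of conditional means, known only up to a null
    set; this allows replacing them by explicit functions under the conditional expectation. *)
Lemma is_cond_exp_ae (Z Z' W : T -> R) : measurable_fun setT Z ->
  measurable_fun setT Z' -> {ae P, forall w, Z w = Z' w} ->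
  is_cond_exp P G Z W -> is_cond_exp P G Z' W.
Proof.
move=> mZ mZ' ZZ' [[B [GB UB iB]] mW eqW].
have Z'Z : {ae P, forall w, Z' w = Z w} by apply: filterS ZZ' => w ->.
split => //.
  by exists B; split => // k; apply: ae_eq_integrable (iB k) => //; exact: GT.
move=> A GA iA; have mA := GT GA.
have [iW ->] := eqW _ GA (ae_eq_integrable mA mZ Z'Z iA).
split => //; apply: ae_eq_integral => //.
- by apply/measurable_EFinP; exact: measurable_funS mZ.
- by apply/measurable_EFinP; exact: measurable_funS mZ'.
- by apply: filterS ZZ' => w /= ->.
Qed.

(** Once the cover is made disjoint, both integrals over [A] become series with equal terms: for [W]
    because it is nonnegative on [A], for [Z] because it is integrable on [A]. Integrability of [W]
    then follows from the equality. *)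
Let ge0_cover_integral (Z W : T -> R) (B : (set T)^nat) (A : set T) :
  measurable_fun setT W -> (forall k, G (B k)) -> \bigcup_k B k = setT ->
  (forall k C, G C -> C `<=` B k ->
     (\int[P]_(t in C) (W t)%:E = \int[P]_(t in C) (Z t)%:E)%E) ->
  G A -> P.-integrable A (EFin \o Z) -> (forall w, A w -> 0 <= W w) ->
  P.-integrable A (EFin \o W) /\
  (\int[P]_(t in A) (W t)%:E = \int[P]_(t in A) (Z t)%:E)%E.
Proof.
move=> mW GB UB ZW GA iZ W0.
pose F k := A `&` seqDU B k.
have GF k : G (F k).
  by apply: (@measurableI _ TG) => //; apply: (@seqDU_measurable _ TG).
have mF k : measurable (F k) by exact: GT.
have AF : A = \bigcup_k F k.
  by rewrite /F -setI_bigcupr -seqDU_bigcup_eq UB setIT.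
have tF : trivIset setT F by apply: trivIset_setIl; exact: trivIset_seqDU.
have eqWZ : (\int[P]_(t in A) (W t)%:E = \int[P]_(t in A) (Z t)%:E)%E.
  rewrite AF ge0_integral_bigcup//; last 2 first.
  - by apply/measurable_EFinP; exact: measurable_funS mW.
  - by rewrite -AF => w Aw; rewrite lee_fin W0.
  rewrite integral_bigcup//; last by rewrite -AF.
  apply: eq_eseriesr => k _; apply: (ZW k) => //.
  by apply: subIset; right; exact: subset_seqDU.
split=> //; apply/integrableP; split.
  by apply/measurable_EFinP; exact: measurable_funS mW.
rewrite (eq_integral (fun w => (W w)%:E)).
  by rewrite eqWZ; apply: integrable_lty => //; exact: GT.
by move=> w /set_mem Aw; rewrite gee0_abs ?lee_fin ?W0.
Qed.

(* [Z] may be integrable on some [A] in [G] although its natural summands are not,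
   so integrability of [W] on [A] is recovered from the pieces of the cover, where
   the sign of [W] can be fixed. *)
Lemma is_cond_exp_cover (Z W : T -> R) (B : (set T)^nat) :
  measurable_fun [set: TG] W ->
  (forall k, G (B k)) -> \bigcup_k B k = setT ->
  (forall k A, G A -> A `<=` B k ->
     [/\ P.-integrable A (EFin \o Z), P.-integrable A (EFin \o W) &
     (\int[P]_(t in A) (W t)%:E = \int[P]_(t in A) (Z t)%:E)%E]) ->
  is_cond_exp P G Z W.
Proof.
move=> mW GB UB ZW; have mWT := preimage_algebra_measurable_fun mf mW.
split.
- by exists B; split => // k; have [] := ZW k _ (GB k).
- exact/preimage_algebra_measurable_funP.
move=> A GA iZ; have mA := GT GA.
(* The sign of [W] splits [A] into two events of [G], since [W] is measurable for [G]. *)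
pose Ap := A `&` [set w | 0 <= W w]; pose An := A `&` [set w | W w < 0].
have GAp : G Ap.
  apply: (@measurableI _ TG) => //.
  have := @measurable_fun_ler _ TG _ _ (cst 0) _ (measurable_cst _) mW.
  by move=> /(_ measurableT [set true]); rewrite setTI; exact.
have GAn : G An.
  apply: (@measurableI _ TG) => //.
  have := @measurable_fun_ltr _ TG _ _ _ (cst 0) mW (measurable_cst _).
  by move=> /(_ measurableT [set true]); rewrite setTI; exact.
have AU : A = Ap `|` An.
  rewrite /Ap /An -setIUr; apply/seteqP; split=> [w Aw|w []//].
  by split=> //=; have [h|h] := leP 0 (W w); [left|right].
have dA : [disjoint Ap & An].
  apply/disj_set2P; rewrite -subset0 => w [[_ /= h] [_ /=]].
  by rewrite ltNge h.
have mAp := GT GAp; have mAn := GT GAn.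
have iZp : P.-integrable Ap (EFin \o Z) by apply: integrableS iZ => // w [].
have iZn : P.-integrable An (EFin \o Z) by apply: integrableS iZ => // w [].
have [iWp eqp] : P.-integrable Ap (EFin \o W) /\
    (\int[P]_(t in Ap) (W t)%:E = \int[P]_(t in Ap) (Z t)%:E)%E.
  by apply: (ge0_cover_integral mWT GB UB) => // [k C GC CB|w []//];
     have [] := ZW k C GC CB.
(* The negative piece is the nonnegative case for [- W] and [- Z]. *)
have [iWn' eqn'] : P.-integrable An (EFin \o (\- W)) /\
    (\int[P]_(t in An) ((\- W) t)%:E = \int[P]_(t in An) ((\- Z) t)%:E)%E.
  apply: (ge0_cover_integral _ GB UB) => //.
  - exact: measurable_funN.
  - move=> k C GC CB; have [iZC iWC eqC] := ZW k C GC CB.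
    under eq_integral do rewrite EFinN.
    under [RHS]eq_integral do rewrite EFinN.
    by rewrite !integralN ?integrable_add_def//= ?eqC//; exact: GT.
  - by have := integrableN iZn.
  - by move=> w [_ /= /ltW]; rewrite oppr_ge0.
have iWn : P.-integrable An (EFin \o W).
  have := integrableN iWn'; apply: eq_integrable => // w _ /=.
  by rewrite opprK.
have eqn : (\int[P]_(t in An) (W t)%:E = \int[P]_(t in An) (Z t)%:E)%E.
  apply: oppe_inj; rewrite -integralN; last exact: integrable_add_def.
  by rewrite -integralN; last exact: integrable_add_def.
split; last first.
  rewrite AU !integral_setU//= -?AU ?eqp ?eqn//.
    exact: measurable_int iZ.
  by apply/measurable_EFinP; exact: measurable_funS mWT.
apply/integrableP; split.
  by apply/measurable_EFinP; exact: measurable_funS mWT.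
rewrite AU ge0_integral_setU//; last first.
  by rewrite -AU; apply: measurableT_comp => //; apply/measurable_EFinP; exact: measurable_funS mWT.
by apply: lte_add_pinfty; [have /integrableP[] := iWp|have /integrableP[] := iWn].
Qed.

End cond_exp_theory.

(** * Independence *)

Section independence_theory.
Context {d d1 d2 : measure_display} {T : measurableType d} {R : realType}.
Context {T1 : measurableType d1} {T2 : measurableType d2}.
Variable P : probability T R.

Lemma independent_RV_comp {d3 d4 : measure_display} {T3 : measurableType d3}
    {T4 : measurableType d4} (U : T -> T1) (V : T -> T2)
    (phi : T1 -> T3) (psi : T2 -> T4) :
  measurable_fun setT phi -> measurable_fun setT psi ->
  independent_RV P U V -> independent_RV P (phi \o U) (psi \o V).
Proof.
move=> mphi mpsi indep A B mA mB.
by apply: (indep (phi @^-1` A) (psi @^-1` B)); rewrite -[X in measurable X]setTI; [exact: mphi|exact: mpsi].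
Qed.

Variables (U : {mfun T >-> T1}) (V : {mfun T >-> T2}).
Hypothesis indep : independent_RV P U V.

Let mUV : measurable_fun setT (fun w => (U w, V w)).
Proof. exact: measurable_fun_pair. Qed.

Let UV : {mfun T >-> (T1 * T2)%type} :=
  HB.pack (fun w => (U w, V w)) (isMeasurableFun.Build _ _ _ _ _ mUV).

(** By independence the joint law and the product of the marginal laws agree on rectangles, and this
    determines the product measure. *)
Let jointE (F : T1 * T2 -> \bar R) :
  (\int[distribution P UV]_z F z =
   \int[distribution P U \x distribution P V]_z F z)%E.
Proof.
apply: eq_measure_integral => A mA _; apply/esym.
by apply: product_measure_unique => // B C mB mC; exact: indep.
Qed.

(** The outer integral stays on the sample space, so the integrand on the right is a function of
    [U], as conditioning on [U] requires. *)
Lemma independent_tonelli (F : T1 * T2 -> \bar R) :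
  measurable_fun setT F -> (forall z, 0 <= F z)%E ->
  (\int[P]_w F (U w, V w) =
   \int[P]_w \int[distribution P V]_y F (U w, y))%E.
Proof.
move=> mF F0.
transitivity (\int[distribution P UV]_z F z)%E.
  by rewrite ge0_integral_distribution.
rewrite jointE fubini_tonelli1// ge0_integral_distribution//.
- exact: measurable_fun_fubini_tonelli_F.
- by move=> x; exact: integral_ge0.
Qed.

Lemma independent_fubini (F : T1 * T2 -> \bar R) :
  measurable_fun setT F -> P.-integrable setT (fun w => F (U w, V w)) ->
  (\int[P]_w F (U w, V w) =
   \int[distribution P U]_x \int[distribution P V]_y F (x, y))%E.
Proof.
move=> mF iF.
have iF' : (distribution P U \x distribution P V)%E.-integrable setT F.
  apply/integrableP; split => //; rewrite -jointE.
  rewrite ge0_integral_distribution//; first by have /integrableP[] := iF.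
  exact: measurableT_comp.
transitivity (\int[distribution P UV]_z F z)%E.
  by rewrite integral_distribution.
by rewrite jointE -integral12_prod_meas1.
Qed.

End independence_theory.

(** * Products of independent integrable real variables *)

Section independence_real.
Context {d : measure_display} {T : measurableType d} {R : realType}.
Variable P : probability T R.

(** Tonelli applied to the absolute value of the product gives integrability; Fubini then factors
    the integral. *)
Lemma independent_integralM (U V : T -> R) :
  P.-integrable setT (EFin \o U) -> P.-integrable setT (EFin \o V) ->
  independent_RV P U V ->
  P.-integrable setT (fun w => (U w * V w)%:E) /\
  (\int[P]_w (U w * V w)%:E = (\int[P]_w (U w)%:E) * \int[P]_w (V w)%:E)%E.
Proof.
move=> iU iV indep.
have mU : measurable_fun setT U by apply/measurable_EFinP; exact: measurable_int iU.
have mV : measurable_fun setT V by apply/measurable_EFinP; exact: measurable_int iV.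
pose U' : {mfun T >-> R} := HB.pack U (isMeasurableFun.Build _ _ _ _ _ mU).
pose V' : {mfun T >-> R} := HB.pack V (isMeasurableFun.Build _ _ _ _ _ mV).
have indep' : independent_RV P U' V' by exact: indep.
pose F (z : R * R) := (z.1 * z.2)%:E.
have mF : measurable_fun setT F.
  apply/measurable_EFinP; apply: measurable_funM => //.
have iUV : P.-integrable setT (fun w => (U w * V w)%:E).
  apply/integrableP; split.
    by apply/measurable_EFinP; exact: measurable_funM.
  have -> : (\int[P]_w `|(U w * V w)%:E| = \int[P]_w `|F (U' w, V' w)|)%E by [].
  have mFa : measurable_fun setT (abse \o F) by exact: measurableT_comp.
  rewrite (independent_tonelli indep' mFa); last by move=> z; exact: abse_ge0.
  under eq_integral => w _.
    rewrite (_ : (fun _ => _) = fun y => (`|(U w)%:E| * `|y%:E|)%E); last first.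
      by apply/funext => y /=; rewrite normrM.
    rewrite ge0_integralZl//; last by do 2 apply: measurableT_comp => //.
    over.
  rewrite ge0_integralZr//=; last 2 first.
  - by do 2 apply: measurableT_comp => //.
  - exact: integral_ge0.
  apply: lte_mul_pinfty.
  - exact: integral_ge0.
  - rewrite ge0_fin_numE; last exact: integral_ge0.
    by have /integrableP[] := iU.
  - rewrite ge0_integral_distribution//.
      by have /integrableP[] := iV.
    by apply: measurableT_comp => //; exact: measurableT_comp.
split=> //.
rewrite (independent_fubini indep' (F := F))//.
have EV : (\int[distribution P V']_y y%:E = \int[P]_w (V w)%:E)%E.
  by rewrite integral_distribution.
have iV' : (distribution P V').-integrable setT EFin.
  by apply: integrable_pushforward.
under eq_integral => x _.
  under eq_integral do rewrite /F /= EFinM.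
  rewrite integralZl// EV.
  over.
have /fineK EVfin : (\int[P]_w (V w)%:E)%E \is a fin_num.
  exact: integrable_fin_num.
pose g (x : R) : \bar R := (x%:E * \int[P]_w (V w)%:E)%E.
have mg : measurable_fun setT g by exact: emeasurable_funM.
rewrite (integral_distribution (X := U') mg).
  by rewrite /g /= -EVfin integralZr.
by rewrite /g /comp -EVfin; exact: integrableZr.
Qed.

End independence_real.

(** * Combinations of independent errors *)

Section linear_conditional_expectation.
Context {d d1 : measure_display} {T : measurableType d} {R : realType}.
Context {T1 : measurableType d1}.
Variables (P : probability T R) (f : T -> T1).
Hypothesis mf : measurable_fun setT f.
Let G := g_sigma_algebra_preimage f.
Let TG := g_sigma_algebra_preimageType f.

Lemma independent_RV_preimage_algebra (u e : T -> R) :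
  measurable_fun [set: TG] u -> independent_RV P f e -> independent_RV P u e.
Proof.
move=> /preimage_algebra_measurable_funP mu indep B C mB mC.
have [D mD] := mu B mB; rewrite setTI => <-.
exact: indep.
Qed.

(** Cutting [a] off outside [A] leaves a bounded function that is still measurable for [G], hence
    independent of [e]; the product rule applies to it. *)
Lemma independent_integral_bounded (a e : T -> R) (A : set T) (K : R) :
  measurable_fun [set: TG] a -> G A -> (forall w, A w -> `|a w| <= K) ->
  P.-integrable setT (EFin \o e) -> independent_RV P f e ->
  [/\ P.-integrable A (EFin \o a), P.-integrable A (fun w => (a w * e w)%:E) &
  (\int[P]_(w in A) (a w * e w)%:E =
   (\int[P]_(w in A) (a w)%:E) * \int[P]_w (e w)%:E)%E].
Proof.
move=> ma GA aK ie indep.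
have mA : measurable A by exact: preimage_algebra_measurable GA.
pose u w := a w * \1_A w.
have mu : measurable_fun [set: TG] u.
  by apply: (@measurable_funM _ TG) => //; apply: (@measurable_indic _ TG).
have iA : P.-integrable A (EFin \o a).
  apply: measurable_bounded_integrable => //.
  - by rewrite ltey_eq fin_num_measure.
  - exact/measurable_funTS/(preimage_algebra_measurable_fun mf ma).
  - exists K; split; first exact: num_real.
    by move=> y Ky w Aw /=; apply: le_trans (aK _ Aw) _; exact: ltW.
have uE (g : T -> R) : (fun w => (u w * g w)%:E) = (fun w => (a w * g w)%:E) \_ A.
  apply/funext => w; rewrite patchE /u indicE; case: ifP => _.
    by rewrite mulr1.
  by rewrite mulr0 mul0r.
have uE1 : EFin \o u = (EFin \o a) \_ A.
  apply/funext => w; rewrite patchE /= /u indicE; case: ifP => _.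
    by rewrite mulr1.
  by rewrite mulr0.
have iu : P.-integrable setT (EFin \o u).
  by rewrite uE1; exact/(integrable_mkcond _ mA).1.
have [iue eue] := independent_integralM iu ie (independent_RV_preimage_algebra mu indep).
split => //.
  by apply/(integrable_mkcond _ mA).2; rewrite -uE.
rewrite integral_mkcond -uE eue; congr (_ * _)%E.
by rewrite [RHS]integral_mkcond -uE1.
Qed.

(** The coefficients may fail to be integrable, so the identity is checked on the events where the
    sum of their absolute values is at most [n]. Taking errors for [e] yields conditional means;
    taking products of two errors yields conditional covariances. *)
Lemma is_cond_exp_sum (I : finType) (a e : I -> T -> R) (c : I -> R) :
  (forall k, measurable_fun [set: TG] (a k)) ->
  (forall k, P.-integrable setT (EFin \o e k)) ->
  (forall k, independent_RV P f (e k)) ->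
  (forall k, \int[P]_w (e k w)%:E = (c k)%:E)%E ->
  is_cond_exp P G (fun w => \sum_k a k w * e k w) (fun w => \sum_k a k w * c k).
Proof.
move=> ma ie indep Ee.
pose s w := \sum_k `|a k w|.
have ms : measurable_fun [set: TG] s.
  apply: (@measurable_sum _ TG) => k.
  by apply: (@measurableT_comp _ _ _ TG).
pose B (n : nat) := [set w | s w <= n%:R].
apply: (is_cond_exp_cover mf (B := B)).
- apply: (@measurable_sum _ TG) => k.
  by apply: (@measurable_funM _ TG).
- move=> n.
  have := @measurable_fun_ler _ TG _ _ _ (cst n%:R) ms (measurable_cst _).
  by move=> /(_ measurableT [set true]); rewrite setTI; exact.
- apply/seteqP; split => // w _; exists (Num.truncn (s w)).+1 => //=.
  by apply/ltW; rewrite truncnS_gt.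
- move=> n A GA AB.
  have mA : measurable A by exact: preimage_algebra_measurable GA.
  have aK k w : A w -> `|a k w| <= n%:R.
    move=> /AB; apply: le_trans; rewrite /s (bigD1 k)//= lerDl.
    exact: sumr_ge0.
  have key k := independent_integral_bounded (ma k) GA (aK k) (ie k) (indep k).
  have iac k : P.-integrable A (fun w => (a k w * c k)%:E).
    under eq_fun do rewrite EFinM.
    by apply: integrableZr => //; have [] := key k.
  split.
  + rewrite /comp; under eq_fun do rewrite -sumEFin.
    by apply: integrable_sum => // k _; have [] := key k.
  + by rewrite /comp; under eq_fun do rewrite -sumEFin; exact: integrable_sum.
  + under eq_integral do rewrite -sumEFin.
    under [RHS]eq_integral do rewrite -sumEFin.
    rewrite !integral_sum//; last by move=> k; have [] := key k.
    apply: eq_bigr => k _; have [iak _ ->] := key k.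
    by rewrite Ee -integralZr//; under [RHS]eq_integral do rewrite -EFinM.
Qed.

End linear_conditional_expectation.

(** * Conditional covariance of affine forms in the errors *)

Section cond_cov_linear.
Context {d d1 : measure_display} {T : measurableType d} {R : realType}.
Context {T1 : measurableType d1}.
Variables (P : probability T R) (f : T -> T1).
Hypothesis mf : measurable_fun setT f.
Let G := g_sigma_algebra_preimage f.
Let TG := g_sigma_algebra_preimageType f.

Lemma independent_RV_cst (r : R) : independent_RV P f (cst r).
Proof.
move=> A B mA mB; have [rB|rB] := pselect (B r).
  rewrite (_ : _ @^-1` B = setT); last by apply/seteqP; split.
  by rewrite setIT probability_setT mule1.
rewrite (_ : _ @^-1` B = set0); last by apply/seteqP; split.
by rewrite setI0 measure0 mule0.
Qed.

Variables (I : finType) (eps : I -> T -> R) (s2 : R).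
Hypothesis ieps : forall k, P.-integrable setT (EFin \o eps k).
Hypothesis iepsM :
  forall k l, P.-integrable setT (fun w => (eps k w * eps l w)%:E).
Hypothesis Eeps : forall k, (\int[P]_w (eps k w)%:E = 0)%E.
Hypothesis EepsM : forall k l,
  (\int[P]_w (eps k w * eps l w)%:E = (s2 *+ (k == l))%:E)%E.
Hypothesis indep : forall k, independent_RV P f (eps k).
Hypothesis indepM :
  forall k l, independent_RV P f (fun w => eps k w * eps l w).

(** The errors are centred and independent of [f], so the linear part contributes nothing. *)
Lemma is_cond_exp_affine (m : T -> R) (a : I -> T -> R) :
  measurable_fun [set: TG] m -> (forall k, measurable_fun [set: TG] (a k)) ->
  is_cond_exp P G (fun w => m w + \sum_k a k w * eps k w) m.
Proof.
move=> mm ma.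
(* The affine part is the coefficient of the constant 1, indexed by [None]. *)
pose a' (k : option I) := if k is Some j then a j else m.
pose e' (k : option I) := if k is Some j then eps j else cst 1.
pose c' (k : option I) : R := if k is Some j then 0 else 1.
have sumE (F : option I -> R) : \sum_k F k = F None + \sum_j F (Some j).
  rewrite (bigD1 None)//=; congr (_ + _).
  rewrite (reindex_omap Some id)/=; last by case.
  by apply: eq_bigl => j; rewrite eqxx.
have -> : (fun w => m w + \sum_k a k w * eps k w) =
    fun w => \sum_k a' k w * e' k w.
  by apply/funext => w; rewrite sumE /= mulr1.
have mE : m = fun w => \sum_k a' k w * c' k.
  by apply/funext => w; rewrite sumE /= mulr1 big1 ?addr0// => j _; rewrite mulr0.
rewrite [X in is_cond_exp _ _ _ X]mE.
apply: (is_cond_exp_sum mf) => [[j|]|[j|]|[j|]|[j|]]//=.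
- by apply: finite_measure_integrable_cst.
- exact: independent_RV_cst.
- by rewrite -[RHS](expectation_cst P 1) unlock.
Qed.

(** After centring, the product is a double sum whose coefficients are measurable for [G], with
    products of two errors as variables; orthogonality of the errors leaves the diagonal. *)
Lemma is_cond_exp_cov (m m' : T -> R) (a b : I -> T -> R) :
  measurable_fun [set: TG] m -> measurable_fun [set: TG] m' ->
  (forall k, measurable_fun [set: TG] (a k)) ->
  (forall k, measurable_fun [set: TG] (b k)) ->
  let U w := m w + \sum_k a k w * eps k w in
  let V w := m' w + \sum_k b k w * eps k w in
  is_cond_exp P G (fun w => (U w - cond_exp P G U w) * (V w - cond_exp P G V w))
    (fun w => s2 * \sum_k a k w * b k w).
Proof.
move=> mm mm' ma mb U V.
have ceU : is_cond_exp P G U m by exact: is_cond_exp_affine.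
have ceV : is_cond_exp P G V m' by exact: is_cond_exp_affine.
have meps k : measurable_fun setT (eps k).
  by apply/measurable_EFinP; exact: measurable_int (ieps k).
have mS (c : I -> T -> R) : (forall k, measurable_fun [set: TG] (c k)) ->
    measurable_fun setT (fun w => \sum_k c k w * eps k w).
  move=> mc; apply: measurable_sum => k; apply: measurable_funM => //.
  exact: (preimage_algebra_measurable_fun mf).
have mce Z W : is_cond_exp P G Z W -> measurable_fun setT (cond_exp P G Z).
  move=> /cond_expP ceZ; apply: (preimage_algebra_measurable_fun mf).
  exact: is_cond_exp_measurable ceZ.
(* The chosen conditional means equal [m] and [m'] almost surely, so the centred factors may be
   replaced by the linear parts. *)
apply: (is_cond_exp_ae mf (Z := fun w =>
    (\sum_k a k w * eps k w) * (\sum_k b k w * eps k w))).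
- by apply: measurable_funM; exact: mS.
- apply: measurable_funM; apply: measurable_funB; try exact: mce ceU; try exact: mce ceV.
    by apply: measurable_funD; [exact: (preimage_algebra_measurable_fun mf)|exact: mS].
  by apply: measurable_funD; [exact: (preimage_algebra_measurable_fun mf)|exact: mS].
- apply: filterS2 (cond_exp_ae mf ceU) (cond_exp_ae mf ceV) => w -> ->.
  by rewrite /U /V !(addrC (_ w)) !addrK.
(* Indexing by pairs turns the product of sums into a single sum, to which [is_cond_exp_sum]
   applies. *)
pose ab (p : I * I) w := a p.1 w * b p.2 w.
have -> : (fun w => (\sum_k a k w * eps k w) * (\sum_k b k w * eps k w)) =
    fun w => \sum_p ab p w * (eps p.1 w * eps p.2 w).
  apply/funext => w; rewrite big_distrlr/= pair_bigA/=.
  by apply: eq_bigr => p _; rewrite /ab mulrACA.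
have -> : (fun w => s2 * \sum_k a k w * b k w) =
    fun w => \sum_p ab p w * (s2 *+ (p.1 == p.2)).
  apply/funext => w; rewrite -(pair_bigA _ (fun k l => ab (k, l) w * (s2 *+ (k == l))))/=.
  rewrite mulr_sumr; apply: eq_bigr => k _.
  rewrite (bigD1 k)//= eqxx big1 ?addr0; first by rewrite mulrC.
  by move=> l lk; rewrite eq_sym (negbTE lk) mulr0.
apply: (is_cond_exp_sum mf) => p.
- by apply: (@measurable_funM _ TG).
- exact: iepsM.
- exact: indepM.
- exact: EepsM.
Qed.

(** Measurability of the chosen version is kept alongside its value because the covariance is later
    squared and conditioned again. *)
Lemma cond_cov_affine (m m' : T -> R) (a b : I -> T -> R) :
  measurable_fun [set: TG] m -> measurable_fun [set: TG] m' ->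
  (forall k, measurable_fun [set: TG] (a k)) ->
  (forall k, measurable_fun [set: TG] (b k)) ->
  let C := cond_cov P G (fun w => m w + \sum_k a k w * eps k w)
                        (fun w => m' w + \sum_k b k w * eps k w) in
  measurable_fun [set: TG] C /\
  {ae P, forall w, C w = s2 * \sum_k a k w * b k w}.
Proof.
move=> mm mm' ma mb C; have ceC := is_cond_exp_cov mm mm' ma mb.
by split; [exact: is_cond_exp_measurable (cond_expP ceC)|exact: cond_exp_ae ceC].
Qed.

End cond_cov_linear.

(** * Integrating out an independent variable *)

Lemma indic_preimage {T T' : Type} {R : pzRingType} (g : T -> T') (A : set T') (w : T) :
  \1_(g @^-1` A) w = \1_A (g w) :> R.
Proof. by rewrite !indicE; congr (_%:R); apply/idP/idP; rewrite !inE. Qed.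

Section nonnegative_conditional_expectation.
Context {d d1 : measure_display} {T : measurableType d} {R : realType}.
Context {T1 : measurableType d1}.
Variables (P : probability T R) (f : T -> T1).
Hypothesis mf : measurable_fun setT f.
Let G := g_sigma_algebra_preimage f.
Let TG := g_sigma_algebra_preimageType f.

Lemma integrable_ge0_sum_term (I : finType) (Z : I -> T -> R) (A : set T) (k : I) :
  (forall i, measurable_fun setT (Z i)) -> (forall i w, 0 <= Z i w) ->
  measurable A ->
  P.-integrable A (EFin \o (fun w => \sum_i Z i w)) ->
  P.-integrable A (EFin \o Z k).
Proof.
move=> mZ Z0 mA; apply: le_integrable => //.
  by apply/measurable_EFinP; exact: measurable_funS (mZ k).
move=> w _ /=; rewrite lee_fin !ger0_norm//; last exact: sumr_ge0.
by rewrite (bigD1 k)//= lerDl; exact: sumr_ge0.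
Qed.

(** Nonnegativity makes each term integrable on every event where the sum is, so additivity of the
    integral applies there. *)
Lemma is_cond_exp_ge0_sum (I : finType) (Z W : I -> T -> R) :
  (forall i, measurable_fun setT (Z i)) -> (forall i w, 0 <= Z i w) ->
  cond_integrable P G (fun w => \sum_i Z i w) ->
  (forall i, is_cond_exp P G (Z i) (W i)) ->
  is_cond_exp P G (fun w => \sum_i Z i w) (fun w => \sum_i W i w).
Proof.
move=> mZ Z0 ciZ ceZ; split => //.
  apply/preimage_algebra_measurable_funP; apply: (@measurable_sum _ TG) => i.
  exact: is_cond_exp_measurable (ceZ i).
move=> A GA iZ; have mA : measurable A by exact: preimage_algebra_measurable GA.
have iZk k := integrable_ge0_sum_term k mZ Z0 mA iZ.
have iW k : P.-integrable A (EFin \o W k) by have [_ _ /(_ A GA (iZk k))[]] := ceZ k.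
split.
  by rewrite /comp; under eq_fun do rewrite -sumEFin;
     apply: integrable_sum => // k _; exact: iW.
under eq_integral do rewrite -sumEFin.
under [RHS]eq_integral do rewrite -sumEFin.
rewrite !integral_sum//.
by apply: eq_bigr => k _; have [_ _ /(_ A GA (iZk k))[]] := ceZ k.
Qed.

End nonnegative_conditional_expectation.

Section independent_conditional_expectation.
Context {d d1 d2 : measure_display} {T : measurableType d} {R : realType}.
Context {T1 : measurableType d1} {T2 : measurableType d2}.
Variables (P : probability T R) (f : {mfun T >-> T1}) (g : {mfun T >-> T2}).
Hypothesis indep : independent_RV P f g.
Let G := g_sigma_algebra_preimage f.
Variable F : T1 * T2 -> R.
Hypothesis mF : measurable_fun setT F.
Hypothesis F0 : forall z, 0 <= F z.

(** With [f] frozen, [g] is averaged under its own law. The partial integral may be infinite at some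
    points, where [fine] returns 0; these points are negligible on every event over which the
    function is integrable. *)
Lemma is_cond_exp_independent :
  cond_integrable P G (fun w => F (f w, g w)) ->
  is_cond_exp P G (fun w => F (f w, g w))
    (fun w => fine (\int[distribution P g]_y (F (f w, y))%:E)%E).
Proof.
move=> ciF.
pose phi x := (\int[distribution P g]_y (F (x, y))%:E)%E.
have mphi : measurable_fun setT phi.
  apply: (measurable_fun_fubini_tonelli_F (fun z => (F z)%:E)).
    exact/measurable_EFinP.
  by move=> z; rewrite lee_fin.
have phi0 x : (0 <= phi x)%E by apply: integral_ge0 => y _; rewrite lee_fin.
have mphif : measurable_fun setT (phi \o f) by exact: measurableT_comp.
split => //.
  apply/preimage_algebra_measurable_funP.
  apply: (preimage_algebra_comp (f := f) (phi := fine \o phi)).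
  exact: measurableT_comp.
move=> A GA iF.
have mA : measurable A by apply: preimage_algebra_measurable GA.
have eqF : (\int[P]_(w in A) phi (f w) = \int[P]_(w in A) (F (f w, g w))%:E)%E.
  have [B mB] := GA; rewrite setTI => AB.
  (* Since [A] is the preimage of [B] under [f], its indicator is a function of [f] and can be
     absorbed into the integrand before Tonelli. *)
  pose FB (z : T1 * T2) := ((\1_B z.1) * F z)%:E.
  rewrite [RHS]integral_mkcond [LHS]integral_mkcond.
  transitivity (\int[P]_w FB (f w, g w))%E; last first.
    apply: eq_integral => w _; rewrite /FB patchE /= indicE -AB.
    have -> : (w \in f @^-1` B) = (f w \in B) by apply/idP/idP; rewrite !inE.
    by case: ifP => _; rewrite ?mul1r ?mul0r.
  rewrite (independent_tonelli indep (F := FB)); last 2 first.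
  - apply/measurable_EFinP; apply: measurable_funM => //.
    by apply: measurableT_comp => //; exact: measurable_indic.
  - by move=> z; rewrite lee_fin mulr_ge0.
  apply: eq_integral => w _; rewrite /FB patchE /= indicE -AB.
  have -> : (w \in f @^-1` B) = (f w \in B) by apply/idP/idP; rewrite !inE.
  case: ifP => _.
    by under eq_integral do rewrite mul1r.
  by under eq_integral do rewrite mul0r; rewrite integral0.
have iphi : P.-integrable A (phi \o f).
  apply/integrableP; split; first exact: measurable_funS mphif.
  under eq_integral => w _ do rewrite (gee0_abs (phi0 (f w))).
  by rewrite eqF; exact: (integrable_lty mA iF).
(* Integrability over [A] makes the partial integral finite almost everywhere on [A], so [fine] does
   not change its integral. *)
have aephi : ae_eq P A (phi \o f) (EFin \o fine \o phi \o f).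
  by apply: filterS (integrable_ae mA iphi) => w /= fin Aw; rewrite fineK// fin.
have mfine : measurable_fun A (EFin \o fine \o phi \o f).
  apply/measurable_EFinP; apply: measurable_funS (_ : measurable_fun setT _) => //.
  by apply: measurableT_comp => //; exact: measurableT_comp.
have intE : (\int[P]_(w in A) (fine (phi (f w)))%:E = \int[P]_(w in A) phi (f w))%E.
  apply: ae_eq_integral => //; first exact: measurable_funS mphif.
  exact: ae_eq_sym.
split; last by rewrite intE eqF.
apply/integrableP; split => //.
under eq_integral => w _ do rewrite /= (ger0_norm (fine_ge0 (phi0 (f w)))).
by rewrite intE eqF; exact: (integrable_lty mA iF).
Qed.

End independent_conditional_expectation.

(** * Independence of a pair from a third variable *)

Section independence_of_triple.
Context {d d1 d2 d3 : measure_display} {T : measurableType d} {R : realType}.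
Context {T1 : measurableType d1} {T2 : measurableType d2} {T3 : measurableType d3}.
Variables (P : probability T R).
Variables (U : {mfun T >-> T1}) (V : {mfun T >-> T2}) (W : {mfun T >-> T3}).

(** For a fixed value of [U], the event reduces to [V] lying in a section of [A] and [W] lying in
    [B], which factors by independence of [V] and [W]. Integrating over [U] treats arbitrary
    measurable [A], not only rectangles. *)
Lemma independent_RV_pair :
  independent_RV P U (fun w => (V w, W w)) -> independent_RV P V W ->
  independent_RV P (fun w => (U w, V w)) W.
Proof.
move=> indU indVW A B mA mB.
have mVW : measurable_fun setT (fun w => (V w, W w)) by exact: measurable_fun_pair.
pose VW : {mfun T >-> (T2 * T3)%type} :=
  HB.pack (fun w => (V w, W w)) (isMeasurableFun.Build _ _ _ _ _ mVW).
have indU' : independent_RV P U VW by exact: indU.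
have indUV : independent_RV P U V.
  by have := independent_RV_comp (phi := id) (psi := fst) _ _ indU; apply.
(* Here [v] stands for a value of [U]: the event is that [V] falls in the section of [A] at [v]. *)
pose S v := V @^-1` [set y | A (v, y)].
have mS v : measurable [set y | A (v, y)].
  by rewrite (_ : [set _ | _] = xsection A v);
     [exact: measurable_xsection|apply/seteqP; split => y; rewrite /xsection/= inE].
have mpre d' (T' : measurableType d') (X : {mfun T >-> T'}) C :
    measurable C -> measurable (X @^-1` C).
  by move=> mC; rewrite -[X in measurable X]setTI; exact: measurable_funPT.
pose FA (z : T1 * T2) : \bar R := (\1_A z)%:E.
pose FAB (z : T1 * (T2 * T3)) : \bar R := (\1_A (z.1, z.2.1) * \1_B z.2.2)%:E.
have mIA : measurable_fun setT (\1_A : T1 * T2 -> R) by exact: measurable_indic.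
have mIB : measurable_fun setT (\1_B : T3 -> R) by exact: measurable_indic.
have mFA : measurable_fun setT FA by exact/measurable_EFinP.
have mFAB : measurable_fun setT FAB.
  have m12 : measurable_fun setT (fun z : T1 * (T2 * T3) => (z.1, z.2.1)).
    by apply: measurable_fun_pair => //; exact: measurableT_comp.
  have m3 : measurable_fun setT (fun z : T1 * (T2 * T3) => z.2.2).
    exact: measurableT_comp.
  apply/measurable_EFinP; apply: measurable_funM.
    exact: (measurableT_comp mIA m12).
  exact: (measurableT_comp mIB m3).
have mUV : measurable_fun setT (fun w => (U w, V w)) by exact: measurable_fun_pair.
pose UV : {mfun T >-> (T1 * T2)%type} :=
  HB.pack (fun w => (U w, V w)) (isMeasurableFun.Build _ _ _ _ _ mUV).
have Pint C : measurable C -> P C = (\int[P]_w (\1_C w)%:E)%E.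
  by move=> mC; rewrite integral_indic// setIT.
have PS v : P (S v) = (\int[distribution P V]_y FA (v, y))%E.
  have mFv : measurable_fun setT (fun y => FA (v, y)).
    exact/measurable_EFinP/(measurableT_comp mIA (pair1_measurable v)).
  rewrite Pint; last exact: mpre.
  rewrite ge0_integral_distribution//; last by move=> y; rewrite lee_fin.
have PUV : P (UV @^-1` A) = (\int[P]_w P (S (U w)))%E.
  rewrite Pint; last exact: mpre.
  under eq_integral do rewrite indic_preimage.
  rewrite (independent_tonelli indUV mFA); last by move=> z; rewrite lee_fin.
  by apply: eq_integral => w _; rewrite PS.
rewrite [X in (_ = X * _)%E]PUV -ge0_integralZr//; last first.
  under eq_fun do rewrite PS.
  apply: (measurableT_comp (f := fubini_F (distribution P V) FA)) => //.
  by apply: measurable_fun_fubini_tonelli_F => // z; rewrite lee_fin.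
rewrite Pint; last by apply: measurableI; [exact: (mpre _ _ UV)|exact: mpre].
transitivity (\int[P]_w FAB (U w, VW w))%E.
  by apply: eq_integral => w _; rewrite indicI/= !indic_preimage.
rewrite (independent_tonelli indU' mFAB); last by move=> z; rewrite lee_fin mulr_ge0.
(* Both sides are now integrals over [U]; the integrands agree pointwise by [indVW] applied to the
   section. *)
apply: eq_integral => w _; rewrite ge0_integral_distribution//.
- rewrite -indVW//= [RHS]Pint; last by apply: measurableI; exact: mpre.
  by apply: eq_integral => w' _; rewrite indicI/= !indic_preimage.
- exact: measurable_fun_pair2.
- by move=> z; rewrite lee_fin mulr_ge0.
Qed.

End independence_of_triple.

(** * The regression model *)

Section measurable_matrix_functions.
Context {d d' : measure_display} {T : measurableType d} {Y : measurableType d'}.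
Variables m n : nat.

Lemma measurable_mx_entry (i : 'I_m) (j : 'I_n) :
  measurable_fun setT (fun M : 'M[T]_(m, n) => M i j).
Proof.
move=> _ B mB; rewrite setTI; apply: sub_sigma_algebra.
by exists (i, j) => //; exists B => //; rewrite setTI.
Qed.

(** The entry preimages generate the sigma-algebra on matrices, so testing them is enough. *)
Lemma measurable_fun_mx (g : Y -> 'M[T]_(m, n)) :
  (forall i j, measurable_fun setT (fun y => g y i j)) -> measurable_fun setT g.
Proof.
move=> mg; apply: (@measurability _ _ _ _ _ _ (\bigcup_(ij : 'I_m * 'I_n)
  preimage_set_system setT (fun A : 'M[T]_(m, n) => A ij.1 ij.2) measurable)) => //.
move=> _ [A [[i j] _ [B mB <-]] <-]; rewrite !setTI.
by rewrite -[X in measurable X]setTI; exact: mg.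
Qed.

End measurable_matrix_functions.

(** * Moments and independence of the errors in the model *)

Section regression_theory.
Context {R : realType} {disp : measure_display} {Omega : measurableType disp}.
Variables (P : probability Omega R) (n d : nat).
Variables (Theta : Type) (mu : 'cV[R]_d -> Theta -> R) (beta : Theta).
Variables (x : 'I_n -> {RV P >-> 'cV[R]_d}) (xstar : {RV P >-> 'cV[R]_d}).
Variables (eps : 'I_n -> {RV P >-> R}) (Sigma : 'M[R]_d) (sigma2 : R).
Hypothesis model : regression_model mu beta x xstar eps Sigma sigma2.

Lemma measurable_design_matrix : measurable_fun setT (design_matrix x).
Proof.
apply: measurable_fun_mx => i k; under eq_fun do rewrite mxE.
exact: (measurableT_comp (measurable_mx_entry k 0)).
Qed.

Lemma measurable_error_vector : measurable_fun setT (error_vector eps).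
Proof. apply: measurable_fun_mx => i k; under eq_fun do rewrite mxE.
exact: measurable_funPT. Qed.

HB.instance Definition _ :=
  isMeasurableFun.Build _ _ _ _ (design_matrix x) measurable_design_matrix.
HB.instance Definition _ :=
  isMeasurableFun.Build _ _ _ _ (error_vector eps) measurable_error_vector.

(** The model makes the test point independent of the design and the responses; subtracting the
    means recovers the errors measurably. Independence of design and errors then completes the
    triple. *)
Lemma xstar_design_error_independent :
  independent_RV P (fun w => (xstar w, design_matrix x w)) (error_vector eps).
Proof.
pose X : {mfun Omega >-> 'M[R]_(n, d)} := design_matrix x.
pose e : {mfun Omega >-> 'cV[R]_n} := error_vector eps.
apply: (independent_RV_pair (V := X) (W := e)); last exact: x_eps_independent model.
(* [psi] keeps the design matrix and subtracts from each response the mean computed from the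
   corresponding row. *)
pose psi (z : 'M[R]_(n, d) * 'cV[R]_n) : 'M[R]_(n, d) * 'cV[R]_n :=
  (z.1, \col_i (z.2 i 0 - mu (\col_k z.1 i k) beta)).
have mpsi : measurable_fun setT psi.
  apply: measurable_fun_pair => //; apply: measurable_fun_mx => i j.
  under eq_fun do rewrite mxE; apply: measurable_funB.
    exact: (measurableT_comp (measurable_mx_entry i 0)).
  apply: (measurableT_comp (mu_measurable model)).
  apply: measurable_fun_mx => k l; under eq_fun do rewrite mxE.
  exact: (measurableT_comp (measurable_mx_entry i k)).
have := independent_RV_comp (phi := id) _ mpsi (xstar_independent model).
rewrite (_ : psi \o _ = fun w => (X w, e w)); first by apply.
apply/funext => w.
have rowE i : \col_k design_matrix x w i k = x i w.
  by apply/matrixP => k l; rewrite !mxE ord1.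
have -> : e w = \col_i (response mu beta x eps w i 0
    - mu (\col_k design_matrix x w i k) beta).
  apply/matrixP => i j; rewrite mxE [RHS]mxE rowE mxE.
  by rewrite addrAC subrr add0r.
by [].
Qed.

Lemma error_integrable k : P.-integrable setT (EFin \o eps k).
Proof.
apply/Lfun1_integrable; apply: Lfun_subset12; first by rewrite fin_num_measure.
exact: eps_square_integrable model _.
Qed.

Lemma error_mul_integrable k l :
  P.-integrable setT (fun w => (eps k w * eps l w)%:E).
Proof.
by apply/Lfun1_integrable; apply: Lfun2_mul_Lfun1;
  exact: eps_square_integrable model _.
Qed.

Lemma error_mean k : (\int[P]_w (eps k w)%:E = 0)%E.
Proof. by have := eps_mean model k; rewrite unlock. Qed.

Lemma error_mul_mean k l :
  (\int[P]_w (eps k w * eps l w)%:E = (sigma2 *+ (k == l))%:E)%E.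
Proof.
have [<-|kl] := eqVneq k l.
  have := eps_variance model k; rewrite varianceE; last exact: eps_square_integrable model _.
  by rewrite (eps_mean model) expe2 mule0 sube0 unlock.
have indep : independent_RV P (eps k) (eps l).
  move=> A B mA mB.
  (* Pairwise independence is mutual independence on the index set of [k] and [l], with the event
     [A] at [k] and [B] at every other index. *)
  have := eps_independent model [set k; l]%SET (A := fun i => if i == k then A else B).
  move=> /(_ (fun i => _)) h; rewrite big_setU1/= ?inE// big_set1 eqxx in h.
  rewrite eq_sym (negbTE kl) in h; rewrite -h; last by move=> i; case: ifP.
  congr (P _); apply/seteqP; split=> [w [Aw Bw] i|w h'] /=.
    by rewrite !inE => /orP[]/eqP->; rewrite ?eqxx// eq_sym (negbTE kl).
  split; first by have /= := h' k; rewrite !inE eqxx/=; apply.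
  by have /= := h' l; rewrite !inE eqxx orbT eq_sym (negbTE kl); apply.
have [_ ->] := independent_integralM (error_integrable k) (error_integrable l) indep.
by rewrite error_mean mul0e.
Qed.

(** Stated for a general [f] so that it serves both conditionings: on the design alone, for fitted
    values, and on the design with the test point, for the prediction. *)
Lemma cond_cov_response {d1 : measure_display} {T1 : measurableType d1}
    (f : Omega -> T1) (c : 'I_n -> Omega -> R) (i : 'I_n) :
  measurable_fun setT f -> independent_RV P f (error_vector eps) ->
  (forall k, measurable_fun [set: g_sigma_algebra_preimageType f]
    (fun w => mu (x k w) beta)) ->
  (forall k, measurable_fun [set: g_sigma_algebra_preimageType f] (c k)) ->
  let C := cond_cov P (g_sigma_algebra_preimage f)
    (fun w => response mu beta x eps w i 0)
    (fun w => \sum_k c k w * response mu beta x eps w k 0) in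
  measurable_fun [set: g_sigma_algebra_preimageType f] C /\
  {ae P, forall w, C w = sigma2 * c i w}.
Proof.
move=> mf indep mm mc C.
(* Kronecker coefficients write the single response as an affine form in all errors; the resulting
   sum then selects [c i]. *)
pose a k (w : Omega) : R := (k == i)%:R.
pose m' w := \sum_k c k w * mu (x k w) beta.
have mm' : measurable_fun [set: g_sigma_algebra_preimageType f] m'.
  apply: (@measurable_sum _ (g_sigma_algebra_preimageType f)) => k.
  by apply: (@measurable_funM _ (g_sigma_algebra_preimageType f)).
have ma k : measurable_fun [set: g_sigma_algebra_preimageType f] (a k).
  exact: measurable_cst.
have sumdelta (F : 'I_n -> R) : \sum_k (k == i)%:R * F k = F i.
  rewrite (bigD1 i)//= eqxx mul1r big1 ?addr0// => k /negbTE ->.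
  by rewrite mul0r.
have ind1 k : independent_RV P f (eps k).
  have := independent_RV_comp (phi := id) _ (measurable_mx_entry k 0) indep.
  rewrite (_ : (fun M : 'cV[R]_n => M k 0) \o error_vector eps = eps k); first by apply.
  by apply/funext => w; rewrite /= mxE.
have ind2 k l : independent_RV P f (fun w => eps k w * eps l w).
  have mkl : measurable_fun setT (fun M : 'cV[R]_n => M k 0 * M l 0).
    by apply: measurable_funM; exact: measurable_mx_entry.
  have := independent_RV_comp (phi := id) _ mkl indep.
  rewrite (_ : _ \o error_vector eps = fun w => eps k w * eps l w); first by apply.
  by apply/funext => w; rewrite /= !mxE.
have [] := cond_cov_affine mf error_integrable error_mul_integrable error_mean
  error_mul_mean ind1 ind2 (mm i) mm' ma mc.
have -> : (fun w => mu (x i w) beta + \sum_k a k w * eps k w) =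
    fun w => response mu beta x eps w i 0.
  by apply/funext => w; rewrite mxE sumdelta.
have -> : (fun w => m' w + \sum_k c k w * eps k w) =
    fun w => \sum_k c k w * response mu beta x eps w k 0.
  apply/funext => w; rewrite -big_split; apply: eq_bigr => k _ /=.
  by rewrite mxE mulrDr.
move=> mC aeC; split => //.
by apply: filterS aeC => w; rewrite sumdelta.
Qed.

End regression_theory.

(** * The difference of the predictive and the classical degrees of freedom *)

Theorem proposition3p1 (R : realType) (disp : measure_display)
  (Omega : measurableType disp) (P : probability Omega R) (n d : nat)
  (Theta : Type) (mu : 'cV[R]_d -> Theta -> R) (beta : Theta)
  (x : 'I_n -> {RV P >-> 'cV[R]_d}) (xstar : {RV P >-> 'cV[R]_d})
  (eps : 'I_n -> {RV P >-> R}) (Sigma : 'M[R]_d) (sigma2 : R)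
  (H : {mfun 'M[R]_(n, d) >-> 'M[R]_n})
  (h : {mfun ('M[R]_(n, d) * 'cV[R]_d)%type >-> 'cV[R]_n})
  (n_gt0 : (0 < n)%N)
  (model : regression_model mu beta x xstar eps Sigma sigma2)
  (h_integrable :
     cond_integrable P (sigma_X x) (fun w => sqnorm (hat_vector x xstar h w))) :
  let y i := fun w => response mu beta x eps w i 0 in
  let muhat j := fun w => fitted mu beta x eps H w j 0 in
  let muhat_star := prediction mu beta x xstar eps h in
  {ae P, forall w,
    df_R x xstar H h w - df_F mu beta x eps H sigma2 w =
    n%:R / 2 *
    \sum_(i < n)
      (cond_exp P (sigma_X x)
         (fun w' => cond_cov P (sigma_xstar_X x xstar) (y i) muhat_star w' ^+ 2
                    / sigma2 ^+ 2) w
       - n%:R^-1 *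
         \sum_(j < n) (cond_cov P (sigma_X x) (y i) (muhat j) w ^+ 2
                       / sigma2 ^+ 2))}.
Proof.
move=> y muhat muhat_star.
have mX := measurable_design_matrix x.
pose f2 w := (xstar w, design_matrix x w).
have mf2 : measurable_fun setT f2 by exact: measurable_fun_pair.
have indXe := x_eps_independent model.
have ind2e := xstar_design_error_independent model.
have mmu (d1 : measure_display) (T1 : measurableType d1) (p : T1 -> 'M[R]_(n, d)) k :
    measurable_fun setT p -> measurable_fun setT (fun z => mu (\col_l p z k l) beta).
  move=> mp; apply: (measurableT_comp (mu_measurable model)).
  apply: measurable_fun_mx => l j; under eq_fun do rewrite mxE.
  exact: (measurableT_comp (measurable_mx_entry k l)).
have rowE w k : \col_l design_matrix x w k l = x k w.
  by apply/matrixP => l j; rewrite !mxE ord1.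
have mm1 k : measurable_fun [set: g_sigma_algebra_preimageType (design_matrix x)]
    (fun w => mu (x k w) beta).
  have := preimage_algebra_comp (f := design_matrix x) (mmu _ _ _ k (@measurable_id _ _ setT)).
  by congr measurable_fun; apply/funext => w; rewrite /= rowE.
have mm2 k : measurable_fun [set: g_sigma_algebra_preimageType f2]
    (fun w => mu (x k w) beta).
  have := preimage_algebra_comp (f := f2) (mmu _ _ _ k (@measurable_snd _ _ _ _)).
  by congr measurable_fun; apply/funext => w; rewrite /= rowE.
have covF i j : {ae P, forall w, cond_cov P (sigma_X x) (y i) (muhat j) w =
    sigma2 * hat_matrix x H w j i}.
  have mH k : measurable_fun [set: g_sigma_algebra_preimageType (design_matrix x)]
      (fun w => hat_matrix x H w j k).
    apply: (preimage_algebra_comp (f := design_matrix x) (phi := fun M => H M j k)).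
    exact: (measurableT_comp (measurable_mx_entry j k)).
  have [_] := cond_cov_response model i mX indXe mm1 mH.
  rewrite (_ : (fun w => \sum_k _) = muhat j)//.
  by apply/funext => w; rewrite /muhat /fitted mxE.
have covR i : measurable_fun [set: g_sigma_algebra_preimageType f2]
     (cond_cov P (sigma_xstar_X x xstar) (y i) muhat_star) /\
   {ae P, forall w, cond_cov P (sigma_xstar_X x xstar) (y i) muhat_star w =
    sigma2 * hat_vector x xstar h w i 0}.
  have mh k : measurable_fun [set: g_sigma_algebra_preimageType f2]
      (fun w => hat_vector x xstar h w k 0).
    (* [f2] lists the test point first whereas [h] expects the design matrix first, hence the
       swap. *)
    apply: (preimage_algebra_comp (f := f2) (phi := fun z => h (z.2, z.1) k 0)).
    apply: (measurableT_comp (measurable_mx_entry k 0)).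
    by apply: measurableT_comp => //; exact: measurable_fun_pair.
  have := cond_cov_response model i mf2 ind2e mm2 mh.
  rewrite (_ : (fun w => \sum_k _) = muhat_star)//.
  apply/funext => w; rewrite /muhat_star /prediction [RHS]mxE.
  by apply: eq_bigr => k _; rewrite [in RHS]mxE.
pose Z i w := hat_vector x xstar h w i 0 ^+ 2.
have mh2 i : measurable_fun setT (fun z : 'M[R]_(n, d) * 'cV[R]_d => h z i 0 ^+ 2).
  apply: measurable_funX.
  exact: (measurableT_comp (measurable_mx_entry i 0)).
have mZ i : measurable_fun setT (Z i).
  apply: (measurableT_comp (mh2 i)); exact: measurable_fun_pair.
have Z0 i w : 0 <= Z i w by exact: sqr_ge0.
have ind12 : independent_RV P (design_matrix x) xstar.
  move=> A B mA mB; rewrite setIC muleC.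
  by have := independent_RV_comp (phi := id) _ (@measurable_fst _ _ _ _)
       (xstar_independent model); apply.
(* The common version of both conditional expectations: the squared entry of the hat vector with the
   test point integrated out and the design fixed. *)
pose W i w :=
  fine (\int[distribution P xstar]_v (h (design_matrix x w, v) i 0 ^+ 2)%:E)%E.
have ceZ i : is_cond_exp P (sigma_X x) (Z i) (W i).
  apply: (is_cond_exp_independent (f := design_matrix x) ind12 (mh2 i)).
    by move=> z; exact: sqr_ge0.
  have [B [GB UB iB]] := h_integrable.
  exists B; split => // k; apply: integrable_ge0_sum_term (iB k) => //.
  by apply: preimage_algebra_measurable (GB k).
have ceS : is_cond_exp P (sigma_X x) (fun w => sqnorm (hat_vector x xstar h w))
    (fun w => \sum_i W i w).
  exact: is_cond_exp_ge0_sum.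
have s2 : sigma2 != 0 by rewrite gt_eqF// (sigma2_gt0 model).
(* The squared covariance over the squared error variance equals [Z i] almost surely, so [W i] is a
   version of its conditional expectation too. *)
have ceC i : is_cond_exp P (sigma_X x) (fun w =>
    cond_cov P (sigma_xstar_X x xstar) (y i) muhat_star w ^+ 2 / sigma2 ^+ 2) (W i).
  have [mC CE] := covR i.
  apply: is_cond_exp_ae (ceZ i) => //.
    apply: measurable_funM => //; apply: measurable_funX.
    exact: preimage_algebra_measurable_fun mC.
  by apply: filterS CE => w ->; rewrite /Z -expr_div_n mulrAC mulfV ?mul1r.
(* The indices are finite in number, so one null set serves all of them. *)
have aeF : {ae P, forall w, forall i j,
    cond_cov P (sigma_X x) (y i) (muhat j) w = sigma2 * hat_matrix x H w j i}.
  by apply: filter_forall => i; apply: filter_forall => j; exact: covF.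
have aeC : {ae P, forall w, forall i, cond_exp P (sigma_X x) (fun w =>
    cond_cov P (sigma_xstar_X x xstar) (y i) muhat_star w ^+ 2 / sigma2 ^+ 2) w = W i w}.
  by apply: filter_forall => i; exact: (cond_exp_ae mX (ceC i)).
have aeS : {ae P, forall w, cond_exp P (sigma_X x)
    (fun w => sqnorm (hat_vector x xstar h w)) w = \sum_i W i w}.
  exact: (cond_exp_ae mX ceS).
apply: filterS3 aeF aeC aeS => w wF wC wS.
(* The diagonal covariances are [sigma2] times the diagonal hat entries; the traces then cancel in
   the difference. *)
have -> : df_F mu beta x eps H sigma2 w = \tr (hat_matrix x H w).
  apply: eq_bigr => i _; move: (wF i i); rewrite /y /muhat => ->.
  by rewrite mulrAC mulfV// mul1r.
rewrite /df_R wS addrAC subrr add0r; congr (_ * _).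
under [RHS]eq_bigr => i _ do rewrite wC.
rewrite sumrB -mulr_sumr; congr (_ - _ * _).
(* The [i]-th diagonal entry of the Gram matrix sums the squares of column [i] of the hat matrix,
   matching the inner sum over [j]. *)
apply: eq_bigr => i _; rewrite mxE; apply: eq_bigr => j _.
by rewrite wF mxE -expr_div_n mulrAC mulfV// mul1r expr2.
Qed.
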